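(* The vector addition game has a value equal to \[ \lambda:=\max_{b\in\mathcal{B}}\ \min_{a\in\mathrm{co}(\mathcal{A})}\|a+b\|. \] Any linear form $\ell$ achieving the maximum in \[ \max_{\ell\in(\mathbb{R}^n)^*,\ \|\ell\|_*\leq1}\ \max_{b\in\mathcal{B}}\ \min_{a\in\mathrm{co}(\mathcal{A})}\ell(a+b) \] is a solution of the eigenproblem $S\ell=\lambda+\ell$. Furthermore, Max has a constant optimal strategy, which consists in always playing some fixed \[ b^*\in\operatorname*{arg\,max}_{b\in\mathcal{B}}\ \min_{a\in\mathrm{co}(\mathcal{A})}\|a+b\|. \] Finally, the function $\phi(x)=\mathrm{dist}(x,-(n+1)\mathrm{co}(\mathcal{A}))$ is distance-like and satisfies $S\phi\leq\lambda+\phi$. Hence, by playing at state $x\in\mathbb{R}^n$ an action $a\in\mathcal{A}$ which achieves the minimum in the expression of $S\phi(x)$, one obtains a stationary optimal strategy of Min.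
   Context: Let $\|\cdot\|$ be a norm on $\mathbb{R}^n$, with dual norm $\|\cdot\|_*$ on $(\mathbb{R}^n)^*$, and let $d(x,y)=\|x-y\|$. Let $\mathcal{A},\mathcal{B}\subset\mathbb{R}^n$ be nonempty compact sets. $\mathrm{co}(\cdot)$ denotes the convex hull and $\mathrm{dist}(x,K)=\inf_{y\in K}\|x-y\|$. Vector addition game: from an initial state $x_0\in\mathbb{R}^n$, at each turn $k\geq1$ player Min chooses $a_k\in\mathcal{A}$, then player Max, having observed $a_k$, chooses $b_k\in\mathcal{B}$, and $x_k=x_{k-1}+a_k+b_k$. A strategy $\sigma$ of Min maps each finite history (of states and actions) to an element of $\mathcal{A}$; a strategy $\tau$ of Max maps each finite history together with Min's next action to an element of $\mathcal{B}$. A strategy of Min is stationary if it depends only on the current state. The payoff is $J_\infty(\sigma,\tau)=\limsup_{k\to\infty}\|a_1+b_1+\cdots+a_k+b_k\|/k$, which Min minimizes and Max maximizes. The value is $\lambda$ if $\inf_\sigma\sup_\tau J_\infty=\sup_\tau\inf_\sigma J_\infty=\lambda$; a strategy $\sigma^*$ of Min is optimal if $J_\infty(\sigma^*,\tau)\leq\lambda$ for all $\tau$, and a strategy $\tau^*$ of Max is optimal if $J_\infty(\sigma,\tau^* )\geq\lambda$ for all $\sigma$. For $v:\mathbb{R}^n\to\mathbb{R}$ 1-Lipschitz, the Shapley operator is $Sv(x)=\min_{a\in\mathcal{A}}\max_{b\in\mathcal{B}}v(x+a+b)$. A 1-Lipschitz function $v:\mathbb{R}^n\to\mathbb{R}$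 is distance-like if for some $x_0\in\mathbb{R}^n$ and $\alpha\in\mathbb{R}$, $v(x)\geq\alpha+\|x-x_0\|$ for all $x$. *)

(* Defs.v *)
From HB Require Import structures.
From mathcomp Require Import all_boot all_order all_algebra.
From mathcomp Require Import all_classical all_reals all_analysis.

Set Implicit Arguments.
Unset Strict Implicit.
Unset Printing Implicit Defensive.

Import Order.TTheory GRing.Theory Num.Theory.
Import numFieldNormedType.Exports.

Local Open Scope classical_set_scope.
Local Open Scope ring_scope.

Section Extrema.
Context {R : realType} {T : Type}.
Implicit Types (D : set T) (f : T -> R).

(* [max_over D f] and [min_over D f] are the maximum and minimum of [f] on [D]
   as soon as [argmax D f] and [argmin D f] are nonempty; otherwise they are
   only a supremum and an infimum, with the value 0 on unbounded or empty
   ranges. *)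
Definition max_over D f : R := sup [set f x | x in D].

Definition min_over D f : R := inf [set f x | x in D].

Definition argmax D f : set T := [set x | D x /\ forall y, D y -> f y <= f x].

Definition argmin D f : set T := [set x | D x /\ forall y, D y -> f x <= f y].

End Extrema.

Section NormedSpace.
Context {R : realType} {n : nat}.
Local Notation V := 'rV[R]_n.
Implicit Types (N : V -> R) (A : set V) (v : V -> R).

(* Nonnegativity of [N] follows from these three properties.  [N] is unrelated
   to the sup norm that 'rV[R]_n carries canonically; only the topology of the
   latter is used, which every norm on R^n induces. *)
Definition is_norm N : Prop :=
  [/\ forall x y, N (x + y) <= N x + N y,
      forall (c : R) x, N (c *: x) = `|c| * N x &
      forall x, N x = 0 -> x = 0].

Definition dual_norm N (l : {scalar V}) : R :=
  sup [set `|l x| | x in [set x | N x <= 1]].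

Definition convex_hull A : set V := smallest (@convex_set R V) A.

Definition dist N (x : V) A : R := inf [set N (x - y) | y in A].

Definition lipschitz1 N v : Prop := forall x y, `|v x - v y| <= N (x - y).

Definition distance_like N v : Prop :=
  lipschitz1 N v /\
  exists (x0 : V) (alpha : R), forall x, alpha + N (x - x0) <= v x.

End NormedSpace.

Section Game.
Context {R : realType} {n : nat}.
Local Notation V := 'rV[R]_n.
Implicit Types (N : V -> R) (A B : set V).

(* A completed turn [(a_k, b_k, x_k)]. *)
Definition turn : Type := (V * V * V)%type.

Definition min_action (r : turn) : V := r.1.1.

Definition max_action (r : turn) : V := r.1.2.

Definition next_state (r : turn) : V := r.2.

(* The initial state [x_0] followed by the completed turns, oldest first. *)
Definition history : Type := (V * seq turn)%type.

Definition current_state (h : history) : V := last h.1 (map next_state h.2).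

(* Strategies are also defined on sequences that are not plays of the game
   (and, for Max, on actions outside Min's action set); those values never
   influence a play. *)
Definition min_strategies A : set (history -> V) :=
  [set sigma | forall h, A (sigma h)].

Definition max_strategies B : set (history -> V -> V) :=
  [set tau | forall h a, B (tau h a)].

Definition stationary (sigma : history -> V) : Prop :=
  forall h h', current_state h = current_state h' -> sigma h = sigma h'.

Fixpoint play (sigma : history -> V) (tau : history -> V -> V) (x0 : V)
    (k : nat) : history :=
  if k is k'.+1 then
    let h := play sigma tau x0 k' in
    let a := sigma h in
    let b := tau h a in
    (h.1, rcons h.2 (a, b, current_state h + a + b))
  else (x0, [::]).

Definition total_move (h : history) : V :=
  \sum_(r <- h.2) (min_action r + max_action r).

(* The sequence is indexed from the first turn, to avoid dividing by 0. *)
Definition payoff N sigma tau (x0 : V) : \bar R :=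
  limn_esup (fun k =>
    (N (total_move (play sigma tau x0 k.+1)) / k.+1%:R)%:E).

Definition has_value N A B (x0 : V) (lambda : R) : Prop :=
  ereal_inf [set ereal_sup [set payoff N sigma tau x0
                             | tau in max_strategies B]
              | sigma in min_strategies A] = lambda%:E /\
  ereal_sup [set ereal_inf [set payoff N sigma tau x0
                             | sigma in min_strategies A]
              | tau in max_strategies B] = lambda%:E.

Definition optimal_min N A B (x0 : V) (lambda : R) (sigma : history -> V) :
    Prop :=
  min_strategies A sigma /\
  forall tau, max_strategies B tau ->
    (payoff N sigma tau x0 <= lambda%:E)%E.

Definition optimal_max N A B (x0 : V) (lambda : R) (tau : history -> V -> V) :
    Prop :=
  max_strategies B tau /\
  forall sigma, min_strategies A sigma ->
    (lambda%:E <= payoff N sigma tau x0)%E.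

Definition shapley A B (v : V -> R) (x : V) : R :=
  min_over A (fun a => max_over B (fun b => v (x + a + b))).

Definition eigenproblem_solution N A B (lambda : R) (v : V -> R) : Prop :=
  lipschitz1 N v /\ forall x, shapley A B v x = lambda + v x.

End Game.

(* Main.v *)
(* Constant play of a maximizer b of the gap works for Max because
   (a_1 + ... + a_k) / k lies in co(A).  For Min, write the projection of x on
   -(n+1) co(A) as -(n+1) c; by Caratheodory c is a convex combination of at
   most n+1 points of A, one of which, say a, has weight at least 1/(n+1).  Then
   (n+1) c - a + a' stays in (n+1) co(A) for every a' in co(A), and taking a' with
   N (a' + b) minimal shows that playing a increases phi by at most lambda.
   Linear eigenvectors exist because a convex set on which N >= m is separated
   from the open N-ball of radius m: Hahn-Banach gives a form l <= N with
   l >= m on the set. *)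
Require Import Defs.
From HB Require Import structures.
From mathcomp Require Import all_boot all_order all_algebra.
From mathcomp Require Import all_classical all_reals all_analysis.
From mathcomp Require Import ring lra.

Import Order.TTheory GRing.Theory Num.Theory.
Import numFieldNormedType.Exports.

Local Open Scope classical_set_scope.
Local Open Scope ring_scope.

Set Implicit Arguments.
Unset Strict Implicit.

(** * Attained maxima and minima *)

Section Extrema.
Context {R : realType} {T : Type}.
Implicit Types (D : set T) (f : T -> R).

Lemma max_overE D f x : argmax D f x -> max_over D f = f x.
Proof.
move=> [Dx fx]; apply/eqP; rewrite eq_le; apply/andP; split.
  by apply: ge_sup => [|_ [y Dy <-]]; [exists (f x), x | exact: fx].
apply: ub_le_sup; last by exists x.
by exists (f x) => _ [y Dy <-]; exact: fx.
Qed.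

Lemma min_overE D f x : argmin D f x -> min_over D f = f x.
Proof.
move=> [Dx fx]; apply/eqP; rewrite eq_le; apply/andP; split.
  apply: ge_inf; last by exists x.
  by exists (f x) => _ [y Dy <-]; exact: fx.
by apply: lb_le_inf => [|_ [y Dy <-]]; [exists (f x), x | exact: fx].
Qed.

Lemma le_max_over D f x : argmax D f !=set0 -> D x -> f x <= max_over D f.
Proof. by move=> [m mm] Dx; rewrite (max_overE mm); case: mm => _; exact. Qed.

Lemma ge_min_over D f x : argmin D f !=set0 -> D x -> min_over D f <= f x.
Proof. by move=> [m mm] Dx; rewrite (min_overE mm); case: mm => _; exact. Qed.

Lemma max_over_le D f c : argmax D f !=set0 ->
  (forall x, D x -> f x <= c) -> max_over D f <= c.
Proof. by move=> [m mm] h; rewrite (max_overE mm); case: mm => + _; exact: h. Qed.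

Lemma min_over_ge D f c : argmin D f !=set0 ->
  (forall x, D x -> c <= f x) -> c <= min_over D f.
Proof. by move=> [m mm] h; rewrite (min_overE mm); case: mm => + _; exact: h. Qed.

End Extrema.

(** * Lipschitz functions and extreme values on compact sets *)

Section Lipschitz.
Context {R : realType} {n : nat}.
Local Notation V := 'rV[R]_n.

(* Lipschitz continuity for the canonical sup norm; by symmetry the one-sided
   inequality suffices. *)
Definition lip (K : R) (f : V -> R) := forall x y, f x - f y <= K * `|x - y|.

Lemma lip_continuous K f : lip K f -> continuous f.
Proof.
move=> fK x; apply/(@cvgrPdist_lt _ _ _ _ (nbhs_filter x)) => e e0.
have K0 : 0 < `|K| + 1 by rewrite ltr_wpDl.
apply/(nbhs_ballP x); exists (e / (`|K| + 1)); first exact: divr_gt0.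
move=> y; rewrite -ball_normE /= => xy.
have KK : K * `|x - y| <= (`|K| + 1) * `|x - y|.
  by rewrite ler_wpM2r// ler_wpDr// ler_norm.
rewrite ltr_norml.
have : (`|K| + 1) * `|x - y| < e by rewrite mulrC -ltr_pdivlMr.
have := fK x y; have := fK y x; rewrite (distrC y x); lra.
Qed.

Lemma argmax_lip K f D : D !=set0 -> compact D -> lip K f -> argmax D f !=set0.
Proof.
move=> D0 cD /lip_continuous cf.
have [x + fx] := compact_EVT_max D0 cD (continuous_subspaceT cf).
by rewrite inE => Dx; exists x; split=> // y Dy; apply: fx; rewrite inE.
Qed.

Lemma argmin_lip K f D : D !=set0 -> compact D -> lip K f -> argmin D f !=set0.
Proof.
move=> D0 cD /lip_continuous cf.
have [x + fx] := compact_EVT_min D0 cD (continuous_subspaceT cf).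
by rewrite inE => Dx; exists x; split=> // y Dy; apply: fx; rewrite inE.
Qed.

(** A minimizer at [y] is a competitor at [x], so a constant [K] common to all actions survives
    minimization. With its dual below, this lets the extreme value theorem be applied to nested
    minima and maxima. *)
Lemma lip_min_over K (f : V -> V -> R) D :
  (forall x, argmin D (f x) !=set0) -> (forall a, D a -> lip K (f ^~ a)) ->
  lip K (fun x => min_over D (f x)).
Proof.
move=> f0 fK x y; have [a ma] := f0 y; rewrite (min_overE ma).
have Da : D a by case: ma.
have := ge_min_over (f0 x) Da; have := fK _ Da x y; lra.
Qed.

Lemma lip_max_over K (f : V -> V -> R) D :
  (forall x, argmax D (f x) !=set0) -> (forall a, D a -> lip K (f ^~ a)) ->
  lip K (fun x => max_over D (f x)).
Proof.
move=> f0 fK x y; have [a ma] := f0 x; rewrite (max_overE ma).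
have Da : D a by case: ma.
have := le_max_over (f0 y) Da; have := fK _ Da x y; lra.
Qed.

Lemma lip_addl K f a : lip K f -> lip K (fun x => f (a + x)).
Proof. by move=> fK x y; rewrite (le_trans (fK _ _))// opprD addrACA subrr add0r. Qed.

Lemma lip_addr K f a : lip K f -> lip K (fun x => f (x + a)).
Proof. by move=> fK x y; rewrite (le_trans (fK _ _))// opprD addrACA subrr addr0. Qed.

Lemma rV_coord_le (x : V) i : `|x ord0 i| <= `|x|.
Proof.
rewrite [leRHS]/Num.norm /= mx_normrE; apply/bigmax_geP; right => /=.
by exists (ord0, i).
Qed.

Lemma linear_lip (l : {scalar V}) : exists K, lip K l.
Proof.
exists (\sum_i `|l (delta_mx 0 i)|) => x y; rewrite -linearB.
rewrite {1}(row_sum_delta (x - y)) linear_sum (le_trans (ler_norm _))//.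
rewrite (le_trans (ler_norm_sum _ _ _))// mulr_suml ler_sum// => i _.
by rewrite linearZ/= normrM mulrC ler_wpM2l// rV_coord_le.
Qed.

End Lipschitz.

(** * Equivalence of norms and the dual norm *)

Section Norm.
Context {R : realType} {n : nat}.
Local Notation V := 'rV[R]_n.
Variable N : V -> R.
Hypothesis normN : is_norm N.

Lemma normD x y : N (x + y) <= N x + N y. Proof. by case: normN. Qed.
Lemma normZ c x : N (c *: x) = `|c| * N x. Proof. by case: normN. Qed.
Lemma norm_eq0 x : N x = 0 -> x = 0. Proof. by case: normN => _ _; exact. Qed.

Lemma norm0 : N 0 = 0. Proof. by rewrite -(scale0r 0) normZ normr0 mul0r. Qed.

Lemma norm_opp x : N (- x) = N x.
Proof. by rewrite -scaleN1r normZ normrN1 mul1r. Qed.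

Lemma normB x y : N (x - y) = N (y - x). Proof. by rewrite -norm_opp opprB. Qed.

Lemma norm_ge0 x : 0 <= N x.
Proof. have := normD x (- x); rewrite subrr norm0 norm_opp; lra. Qed.

Lemma norm_sum I (r : seq I) (F : I -> V) :
  N (\sum_(i <- r) F i) <= \sum_(i <- r) N (F i).
Proof.
elim/big_rec2: _ => [|i y z _ yz]; first by rewrite norm0.
by rewrite (le_trans (normD _ _))// lerD2l.
Qed.

Lemma normB_le x y : N x - N y <= N (x - y).
Proof. by rewrite lerBlDr -{1}(subrK y x) normD. Qed.

Lemma norm_le : exists2 K, 0 <= K & forall x, N x <= K * `|x|.
Proof.
exists (\sum_i N (delta_mx 0 i)) => [|x].
  by apply: sumr_ge0 => i _; exact: norm_ge0.
rewrite {1}(row_sum_delta x) (le_trans (norm_sum _ _))// mulr_suml ler_sum// => i _.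
by rewrite normZ mulrC ler_wpM2l// ?norm_ge0// rV_coord_le.
Qed.

Lemma lipschitz1_lip v : lipschitz1 N v -> exists K, lip K v.
Proof.
move=> v1; have [K _ NK] := norm_le; exists K => x y.
by rewrite (le_trans (ler_norm _))// (le_trans (v1 _ _)).
Qed.

Lemma lipschitz1_norm : lipschitz1 N N.
Proof.
move=> x y; have := normB_le x y; have := normB_le y x; rewrite (normB y x).
rewrite ler_norml; lra.
Qed.

(** [N] is continuous and positive on the compact unit sphere of the sup norm; its minimum there
    serves as [c], by homogeneity. *)
Lemma norm_ge : exists2 c, 0 < c & forall x, c * `|x| <= N x.
Proof.
pose S := [set x : V | `|x| = 1].
(* If the sphere is empty, normalizing shows that every vector is 0, and any constant works. *)
have [S0|S0] := pselect (S !=set0); last first.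
  exists 1 => // x; have [->|x0] := eqVneq x 0; first by rewrite normr0 mulr0 norm0.
  exfalso; apply: S0; exists (`|x|^-1 *: x) => /=.
  by rewrite /S/= mx_normZ ger0_norm ?invr_ge0// mulVf ?normr_eq0.
have cS : compact S.
  apply: bounded_closed_compact.
    by exists 1; split => // M M1 x /= ->; exact: ltW.
  rewrite (_ : S = (fun x : V => `|x|) @^-1` [set 1])//.
  apply: preimage_closed.
    by move=> x _; apply: (@lip_continuous _ _ 1) => y z; rewrite mul1r lerB_dist.
  exact: accessible_closed_set1 (hausdorff_accessible (@norm_hausdorff _ _)) _.
have [K NK] := lipschitz1_lip lipschitz1_norm.
have [m [/= m1 mm]] := argmin_lip S0 cS NK.
exists (N m) => [|x].
  rewrite lt_neqAle norm_ge0 andbT eq_sym; apply/eqP => /norm_eq0 m0.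
  by move: m1; rewrite /S/= m0 normr0 => /eqP; rewrite eq_sym oner_eq0.
have [->|x0] := eqVneq x 0; first by rewrite normr0 mulr0 norm0.
have x1 : 0 < `|x| by rewrite normr_gt0.
have /mm : S (`|x|^-1 *: x).
  by rewrite /S/= mx_normZ ger0_norm ?invr_ge0// mulVf ?normr_eq0.
by rewrite normZ ger0_norm ?invr_ge0// mulrC ler_pdivlMr.
Qed.

Lemma dual_normP (l : {scalar V}) :
  dual_norm N l <= 1 <-> forall x, `|l x| <= N x.
Proof.
split=> [l1 x|lN]; last first.
  apply: ge_sup; last by move=> _ [x /= x1 <-]; exact: le_trans (lN _) x1.
  by exists `|l 0|, 0 => //=; rewrite norm0.
have [->|x0] := eqVneq x 0; first by rewrite linear0 normr0 norm0.
have Nx : 0 < N x.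
  by rewrite lt_neqAle norm_ge0 andbT eq_sym; apply: contra x0 => /eqP/norm_eq0 ->.
have [K lK] := linear_lip l; have [c c0 cN] := norm_ge.
suff : `|l ((N x)^-1 *: x)| <= 1.
  rewrite linearZ/= normrM ger0_norm ?invr_ge0 ?norm_ge0//.
  by rewrite mulrC ler_pdivrMr// mul1r.
apply: le_trans l1; apply: ub_le_sup; last first.
  exists ((N x)^-1 *: x) => //=.
  by rewrite normZ ger0_norm ?invr_ge0 ?norm_ge0// mulVf// gt_eqF.
(* The supremum dominates its members only if the set is bounded: the [N]-unit ball has sup-norm
   radius at most [1 / c], and [l] is [K]-Lipschitz. *)
exists (`|K| / c) => _ [y /= y1 <-].
have y2 : `|y| <= c^-1 by rewrite -[leRHS]div1r ler_pdivlMr// mulrC (le_trans (cN _)).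
have := lK y 0; have := lK 0 y; rewrite sub0r subr0 normrN linear0.
have : K * `|y| <= `|K| / c.
  by rewrite (le_trans (ler_norm _))// normrM normr_id ler_wpM2l.
rewrite ler_norml; lra.
Qed.

End Norm.

(** * Convex hulls: Caratheodory's theorem, compactness, exchange of points *)

Section ConvexHull.
Context {R : realType} {n : nat}.
Local Notation V := 'rV[R]_n.
Implicit Types A C : set V.

Lemma convex_setP C : @convex_set R V C <->
  forall (t : R) x y, 0 <= t -> t <= 1 -> C x -> C y -> C (t *: x + (1 - t) *: y).
Proof.
split=> [cC t x y t0 t1 Cx Cy|cC x y t].
  by have := cC x y (Itv01 t0 t1); rewrite !inE; exact.
by rewrite !inE => Cx Cy; apply: cC.
Qed.

Lemma convex_hullW A x y (t : R) : 0 <= t -> t <= 1 ->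
  convex_hull A x -> convex_hull A y -> convex_hull A (t *: x + (1 - t) *: y).
Proof.
move=> t0 t1 hx hy C [/= cC AC]; move/convex_setP: (cC); apply=> //.
- exact: hx (conj cC AC).
- exact: hy (conj cC AC).
Qed.

Lemma sub_convex_hull A : A `<=` convex_hull A.
Proof. exact: sub_gen_smallest. Qed.

Lemma convex_hull_sub A C :
  (forall (t : R) x y, 0 <= t -> t <= 1 -> C x -> C y ->
    C (t *: x + (1 - t) *: y)) ->
  A `<=` C -> convex_hull A `<=` C.
Proof. by move=> /convex_setP cC AC; apply: smallest_sub. Qed.

Definition combination A m x := exists (a : 'I_m -> V) (w : 'I_m -> R),
  [/\ forall i, A (a i), forall i, 0 <= w i, \sum_i w i = 1 &
      x = \sum_i w i *: a i].

Lemma combination0 A x : ~ combination A 0 x.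
Proof.
by move=> [a [w [_ _]]]; rewrite big_ord0 => /esym/eqP; rewrite oner_eq0.
Qed.

(** Dividing the remaining weights by their sum leaves a combination of [m] points, so inductions
    only need two-point convexity. A zero sum puts all the weight on the first point. *)
Lemma combination_cons A m x : combination A m.+1 x -> A x \/
  exists t a y, [/\ 0 <= t, t <= 1, A a, combination A m y &
                    x = t *: a + (1 - t) *: y].
Proof.
move=> [a [w [Aa w0 w1 ->]]]; move: w1; rewrite !big_ord_recl /= => w1.
have s0 : 0 <= \sum_(i < m) w (lift ord0 i) by apply: sumr_ge0.
have [s00|sn0] := eqVneq (\sum_(i < m) w (lift ord0 i)) 0.
  left; rewrite big1 ?addr0 => [|i _].
    by move: w1; rewrite s00 addr0 => ->; rewrite scale1r.
  by move/psumr_eq0P: s00 => ->//; rewrite scale0r.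
set s := \sum_(i < m) w (lift ord0 i) in w1 s0 sn0.
right; exists (w ord0), (a ord0),
  (s^-1 *: \sum_(i < m) w (lift ord0 i) *: a (lift ord0 i)).
split=> //; first by rewrite -w1 lerDl.
  exists (fun i => a (lift ord0 i)), (fun i => s^-1 * w (lift ord0 i)); split=> //.
  - by move=> i; rewrite mulr_ge0// invr_ge0.
  - by rewrite -mulr_sumr mulVf.
  - by rewrite scaler_sumr; apply: eq_bigr => i _; rewrite scalerA.
by rewrite (_ : 1 - w ord0 = s) ?scalerA ?divff ?scale1r// -w1 addrC addKr.
Qed.

Lemma convex_hull_combination A m x :
  combination (convex_hull A) m x -> convex_hull A x.
Proof.
elim: m x => [x /combination0//|m IH x].
case/combination_cons=> // -[t [a [y [t0 t1 Aa /IH hy ->]]]].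
exact: convex_hullW.
Qed.

Lemma combination1 A x : A x -> combination A 1 x.
Proof.
by move=> Ax; exists (fun=> x), (fun=> 1); split=> //; rewrite big_ord1 ?scale1r.
Qed.

Lemma combination_conv A m1 m2 x y (t : R) : 0 <= t -> t <= 1 ->
  combination A m1 x -> combination A m2 y ->
  combination A (m1 + m2) (t *: x + (1 - t) *: y).
Proof.
move=> t0 t1 [a [w [Aa w0 w1 ->]]] [b [v [Ab v0 v1 ->]]].
exists (fun i : 'I_(m1 + m2) =>
    match fintype.split i with inl j => a j | inr j => b j end),
  (fun i : 'I_(m1 + m2) =>
    match fintype.split i with inl j => t * w j | inr j => (1 - t) * v j end).
split.
- by move=> i; case: fintype.split.
- by move=> i; case: fintype.split => j; rewrite mulr_ge0// subr_ge0.
- rewrite big_split_ord/=.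
  under eq_bigr do rewrite (unsplitK (inl _)).
  under [X in _ + X]eq_bigr do rewrite (unsplitK (inr _)).
  by rewrite -!mulr_sumr w1 v1; ring.
- rewrite big_split_ord/= !scaler_sumr; congr (_ + _); apply: eq_bigr => i _.
    by rewrite (unsplitK (inl _)) scalerA.
  by rewrite (unsplitK (inr _)) scalerA.
Qed.

(* An affine dependence between the points can be subtracted from the weights
   until one of them vanishes. *)
Lemma combination_drop A m x : (n < m)%N ->
  combination A m.+1 x -> combination A m x.
Proof.
move=> nm [a [w [Aa w0 w1 ->]]].
have [u u0 [ua us]] : exists2 u : 'I_m.+1 -> R, exists i, u i != 0 &
    \sum_i u i *: a i = 0 /\ \sum_i u i = 0.
  (* The [m + 1] rows [(a i, 1)] have rank at most [n + 1 < m + 1]. A nonzero [u] in the left kernel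
     is an affine dependence, the column of ones giving the zero sum. *)
  pose M := row_mx (\matrix_i a i) (const_mx 1 : 'cV[R]_m.+1).
  have /rowV0Pn[u /sub_kermxP] : kermx M != 0.
    rewrite -mxrank_eq0 mxrank_ker -lt0n subn_gt0.
    by rewrite (leq_ltn_trans (rank_leq_col M))// addn1.
  move=> uM u0.
  have /eq_row_mx[ua us] :
      row_mx (u *m \matrix_i a i) (u *m (const_mx 1 : 'cV[R]_m.+1)) = row_mx 0 0.
    by rewrite -mul_mx_row uM row_mx0.
  exists (u ord0).
    apply/existsP; apply: contraNT u0 => /existsPn u0; apply/eqP/rowP => i.
    by rewrite mxE; apply/eqP; have := u0 i; rewrite negbK.
  split.
    by rewrite -[RHS]ua mulmx_sum_row; apply: eq_bigr => i _; rewrite rowK.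
  have /rowP/(_ 0) := us; rewrite !mxE => {2}<-.
  by apply: eq_bigr => i _; rewrite mxE mulr1.
have [i0 ui0] : exists i, 0 < u i.
  apply: contrapT => un; case: u0 => i /eqP; apply.
  have un0 j : u j <= 0 by rewrite leNgt; apply/negP => uj; apply: un; exists j.
  apply/eqP; rewrite -oppr_eq0; apply/eqP; move: i (erefl true) => i _.
  apply: (@psumr_eq0P _ _ xpredT (fun i => - u i)) => //.
    by move=> j _; rewrite oppr_ge0.
  by rewrite sumrN us oppr0.
(* The least ratio is the largest multiple of [u] that keeps all weights nonnegative, and it
   annihilates the weight [j]. *)
case: (@arg_minP _ _ _ i0 (fun i => 0 < u i) (fun i => w i / u i) ui0) => j uj jmin.
set t := w j / u j.
have t0 : 0 <= t by rewrite divr_ge0// ltW.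
pose w' i := w i - t * u i.
have w'j : w' j = 0 by rewrite /w' /t divfK ?subrr// gt_eqF.
have w'0 i : 0 <= w' i.
  rewrite subr_ge0; have [ui|ui] := leP (u i) 0.
    by rewrite (le_trans _ (w0 i))// mulr_ge0_le0.
  by rewrite -ler_pdivlMr// jmin.
exists (a \o lift j), (w' \o lift j); split=> /=.
- by move=> i; exact: Aa.
- by move=> i; exact: w'0.
- have : \sum_i w' i = 1 by rewrite /w' sumrB -mulr_sumr us mulr0 subr0.
  by rewrite (bigD1_ord j)//= w'j add0r.
- have -> : \sum_i w i *: a i = \sum_i w' i *: a i.
    rewrite /w'; under [RHS]eq_bigr do rewrite scalerBl -scalerA.
    by rewrite sumrB -scaler_sumr ua scaler0 subr0.
  by rewrite (bigD1_ord j)//= w'j scale0r add0r.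
Qed.

(** Combinations of arbitrary length form a convex set containing [A], hence its hull; dropping
    points then brings the length down to at most [n + 1]. *)
Lemma caratheodory A x : convex_hull A x ->
  exists2 m, (m <= n.+1)%N & combination A m x.
Proof.
move=> hx; have [m] : exists m, combination A m x.
  move: x hx; apply: convex_hull_sub => [t y z t0 t1 [p yp] [q zq]|y Ay].
    by exists (p + q)%N; exact: combination_conv.
  by exists 1%N; exact: combination1.
elim: m => [|m IH] mx; first by exists 0%N.
by have [mn|nm] := leqP m n; [exists m.+1 | exact/IH/combination_drop].
Qed.

(* Convex combinations of k+1 points, presented so that compactness follows from
   that of binary products. *)
Fixpoint iter_hull A k : set V :=
  if k is k'.+1 then
    [set p.1.1 *: p.1.2 + (1 - p.1.1) *: p.2 |
      p in (`[0, 1] : set R) `*` A `*` iter_hull A k']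
  else A.

Lemma iter_hull_sub A k : iter_hull A k `<=` convex_hull A.
Proof.
elim: k => [|k IH]; first exact: sub_convex_hull.
move=> _ [[[t a] y] /= [[+ Aa] /IH hy] <-]; rewrite in_itv/= => /andP[t0 t1].
by apply: convex_hullW => //; exact: sub_convex_hull.
Qed.

Lemma iter_hull_compact A k : compact A -> compact (iter_hull A k).
Proof.
move=> cA; elim: k => [//|k IH]; apply: continuous_compact.
  apply: continuous_subspaceT => -[[t a] y] /=.
  apply: cvgD; apply: cvgZ.
  - by apply: (@cvg_comp _ _ _ fst fst); [exact: cvg_fst | exact: cvg_fst].
  - by apply: (@cvg_comp _ _ _ fst snd); [exact: cvg_fst | exact: cvg_snd].
  - apply: cvgB; first exact: cvg_cst.
    by apply: (@cvg_comp _ _ _ fst fst); [exact: cvg_fst | exact: cvg_fst].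
  - exact: cvg_snd.
by apply: compact_setX => //; apply: compact_setX => //; exact: segment_compact.
Qed.

Lemma iter_hullS A k : iter_hull A k `<=` iter_hull A k.+1.
Proof.
(* A point of weight 0 pads the combination. If [A] is empty, so is its hull, and there is nothing
   to pad. *)
have [[a Aa]|A0] := pselect (A !=set0); last first.
  move=> x /iter_hull_sub/(@convex_hull_sub _ set0)[] // y Ay.
  by apply: A0; exists y.
move=> x hx; exists (0, a, x) => /=; last by rewrite scale0r add0r subr0 scale1r.
by rewrite in_itv/= lexx ler01.
Qed.

Lemma combination_iter_hull A k x : combination A k.+1 x -> iter_hull A k x.
Proof.
have sub j : A `<=` iter_hull A j.
  by elim: j => [//|j IH] y /IH; exact: iter_hullS.
elim: k x => [|k IH] x /combination_cons[/sub//|[t [a [y [t0 t1 Aa yk ->]]]]].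
  by have := combination0 yk.
by exists (t, a, y) => //=; split; [rewrite in_itv/= t0 t1 | exact: IH].
Qed.

(** By Caratheodory's theorem the hull is exhausted by the single compact set [iter_hull A n],
    shorter combinations being padded. *)
Lemma compact_convex_hull A : compact A -> compact (convex_hull A).
Proof.
move=> /(@iter_hull_compact A n); congr compact; apply/seteqP; split.
  exact: iter_hull_sub.
move=> x /caratheodory[[_ /combination0//|m mn /combination_iter_hull]].
rewrite ltnS in mn; rewrite -(subnK mn).
by elim: (n - m)%N => [//|j IH] /IH; exact: iter_hullS.
Qed.

(** Among at most [n + 1] weights of sum 1, one is at least [1 / (n + 1)]; this much mass can move
    from its point [a] to any [a']. The point [a] is chosen before [a'], as the order of moves in
    the game demands. *)
Lemma convex_hull_exchange A c : convex_hull A c -> exists2 a, A a &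
  forall a', convex_hull A a' -> convex_hull A (c + n.+1%:R^-1 *: (a' - a)).
Proof.
move=> /caratheodory[m mn [a [w [Aa w0 w1 ->]]]].
set s := n.+1%:R^-1; have s0 : 0 <= s by rewrite invr_ge0.
have [j sj] : exists j, s <= w j.
  apply: contrapT => h; have ws i : w i < s.
    by rewrite ltNge; apply/negP => wi; apply: h; exists i.
  have m0 : (0 < m)%N.
    rewrite lt0n; apply/eqP => m0; subst m.
    by move: w1; rewrite big_ord0 => /esym/eqP; rewrite oner_eq0.
  have : \sum_i w i < \sum_(i < m) s.
    by apply: ltr_sum => //; apply/hasP; exists (Ordinal m0); rewrite ?mem_index_enum.
  by rewrite w1 sumr_const card_ord -mulr_natl ltr_pdivlMr// mul1r ltr_nat ltnNge mn.
exists (a j) => // a' ha'.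
pose d i : R := (i == j)%:R.
have d1 : \sum_i d i = 1 by rewrite (bigD1 j)//= /d eqxx big1 ?addr0// => i /negbTE ->.
apply: (@convex_hull_combination A m.+1).
(* The point [a'] is put in front with weight [s], and the weight of [a j] is lowered by [s]. *)
exists (fun i => oapp a a' (unlift ord0 i)),
  (fun i => oapp (fun i => w i - d i * s) s (unlift ord0 i)); split.
- by move=> i; case: unlift => //= k; exact: sub_convex_hull.
- move=> i; case: unlift => //= k; rewrite subr_ge0 /d.
  by case: eqP => [->|_]; rewrite ?mul1r ?mul0r.
- rewrite big_ord_recl unlift_none /=.
  under eq_bigr do rewrite liftK /=.
  by rewrite sumrB w1 -mulr_suml d1 mul1r addrC subrK.
- rewrite big_ord_recl unlift_none /=.
  under [in RHS]eq_bigr do rewrite liftK /= scalerBl.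
  rewrite sumrB scalerBr [RHS]addrCA; congr (_ + (_ - _)).
  rewrite (bigD1 j)//= /d eqxx mul1r big1 ?addr0// => i /negbTE ->.
  by rewrite mul0r scale0r.
Qed.

End ConvexHull.

(** * Hahn-Banach theorem and separation from a norm ball *)

Section HahnBanach.
Context {R : realType} {n : nat}.
Local Notation V := 'rV[R]_n.

(** Storing a form by its coefficients makes a one-dimensional extension the change of one
    coefficient. *)
Definition coord_form (c : 'I_n -> R) (x : V) : R := \sum_i c i * x ord0 i.

Fact coord_form_is_linear c : linear_for *%R (coord_form c).
Proof.
move=> t x y; rewrite /coord_form mulr_sumr -big_split/=.
by apply: eq_bigr => i _; rewrite !mxE; ring.
Qed.

HB.instance Definition _ c :=
  GRing.isLinear.Build R V R *%R (coord_form c) (coord_form_is_linear c).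

(** Induction on [k]: a form dominated by [p] on the span of the first [k] basis vectors is extended
    to the next one. *)
Lemma hahn_banach (p : V -> R) :
  (forall x y, p (x + y) <= p x + p y) ->
  (forall t x, 0 < t -> p (t *: x) <= t * p x) ->
  exists l : {scalar V}, forall x, l x <= p x.
Proof.
move=> pD pZ.
suff : forall k, (k <= n)%N -> exists c, forall x : V,
    (forall i : 'I_n, (k <= i)%N -> x ord0 i = 0) -> coord_form c x <= p x.
  move=> /(_ n (leqnn n))[c lc]; exists (coord_form c) => x.
  by apply: lc => i; rewrite leqNgt ltn_ord.
elim=> [_|k IH kn].
  exists (fun=> 0) => x x0; have {x0}-> : x = 0 by apply/rowP => i; rewrite x0// mxE.
  (* Homogeneity at the origin with factor 2 gives [0 <= p 0]. *)
  have := @pZ 2 0; rewrite ltr0n => /(_ isT); rewrite scaler0 linear0; lra.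
have [c lc] := IH (ltnW kn).
pose k0 := Ordinal kn; pose e : V := delta_mx ord0 k0.
pose W := [set x : V | forall i : 'I_n, (k <= i)%N -> x ord0 i = 0].
have WZ t x : W x -> W (t *: x) by move=> Wx i ki; rewrite mxE Wx// mulr0.
(* Each lower bound that domination imposes on the value at [e] is below each upper bound, so the
   supremum [s] of the former is an admissible value. *)
have sep x y : W x -> W y ->
    coord_form c y - p (y - e) <= p (x + e) - coord_form c x.
  move=> Wx Wy; have Wxy : W (x + y) by move=> i ki; rewrite mxE Wx// Wy// addr0.
  have := lc _ Wxy; have := pD (x + e) (y - e).
  rewrite addrACA subrr addr0 linearD/=; lra.
have W0 : W 0 by move=> i _; rewrite mxE.
pose s := sup [set coord_form c y - p (y - e) | y in W].
have s_ge y : W y -> coord_form c y - p (y - e) <= s.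
  move=> Wy; apply: ub_le_sup; last by exists y.
  by exists (p (0 + e) - coord_form c 0) => _ [z Wz <-]; exact: sep.
have s_le x : W x -> s <= p (x + e) - coord_form c x.
  move=> Wx; apply: ge_sup => [|_ [z Wz <-]]; last exact: sep.
  by exists (coord_form c 0 - p (0 - e)), 0.
exists (fun i => if i == k0 then s else c i) => z Wz.
pose t := z ord0 k0; pose x := z - t *: e.
have Wx : W x.
  move=> i; rewrite leq_eqVlt !mxE => /predU1P[ki|ki].
    have -> : i = k0 by exact/val_inj.
    by rewrite !eqxx mulr1 subrr.
  have -> : (i == k0) = false by apply/eqP => ik; move: ki; rewrite ik ltnn.
  by rewrite Wz// andbF mulr0 subr0.
have zE : z = x + t *: e by rewrite subrK.
have -> : coord_form (fun i => if i == k0 then s else c i) z =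
          coord_form c x + t * s.
  rewrite /coord_form (bigD1 k0)//= eqxx [in RHS](bigD1 k0)//=.
  rewrite (Wx k0)//= mulr0 add0r addrC mulrC; congr (_ + _).
  apply: eq_bigr => i /negbTE ik; rewrite ik !mxE ik andbF mulr0 subr0//.
(* For nonzero [t], dividing by its absolute value reduces [z] to a vector of [W] plus or minus [e],
   where the bounds on [s] apply. *)
have [t0|t0|t0] := ltgtP t 0.
- have t'0 : 0 < (- t)^-1 by rewrite invr_gt0 oppr_gt0.
  have := s_ge _ (WZ (- t)^-1 _ Wx); rewrite linearZ/=.
  have := pZ _ z t'0; rewrite {1}zE scalerDr scalerA invrN mulNr
    mulVf ?lt_eqF// scaleN1r.
  rewrite -invrN => h1 h2.
  have : (- t)^-1 * coord_form c x - (- t)^-1 * p z <= s by lra.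
  rewrite -mulrBr mulrC ler_pdivrMr ?oppr_gt0//; lra.
- have t'0 : 0 < t^-1 by rewrite invr_gt0.
  have := s_le _ (WZ t^-1 _ Wx); rewrite linearZ/=.
  have := pZ _ z t'0; rewrite {1}zE scalerDr scalerA mulVf ?gt_eqF// scale1r => h1 h2.
  have : s <= t^-1 * p z - t^-1 * coord_form c x by lra.
  rewrite -mulrBr mulrC ler_pdivlMr//; lra.
- by rewrite t0 mul0r addr0 zE t0 scale0r addr0; exact: lc.
Qed.

Variable N : V -> R.
Hypothesis normN : is_norm N.

Lemma norm_separation (C : set V) (m : R) : C !=set0 ->
  (forall t x y, 0 <= t -> t <= 1 -> C x -> C y -> C (t *: x + (1 - t) *: y)) ->
  (forall y, C y -> m <= N y) ->
  exists2 l : {scalar V}, forall x, l x <= N x & forall y, C y -> m <= l y.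
Proof.
move=> [y0 Cy0] cC mC.
(* Hahn-Banach is applied to the largest sublinear p with p <= N and
   p (- y) <= - m for y in C. *)
pose S x := [set N (x + ty.1 *: ty.2) - ty.1 * m |
  ty in [set ty : R * V | 0 <= ty.1 /\ C ty.2]].
pose p x := inf (S x).
(* Being bounded below keeps the infimum [p x] from taking its default value 0. *)
have S_ge x : lbound (S x) (- N x).
  move=> _ [[t y] /= [t0 Cy] <-].
  have := normD normN (x + t *: y) (- x); rewrite addrAC subrr add0r norm_opp//.
  rewrite normZ// ger0_norm//; have := ler_wpM2l t0 (mC _ Cy); lra.
have p_le x t y : 0 <= t -> C y -> p x <= N (x + t *: y) - t * m.
  by move=> t0 Cy; apply: ge_inf; [exists (- N x) | exists (t, y)].
have p_ge x c :
    (forall t y, 0 <= t -> C y -> c <= N (x + t *: y) - t * m) -> c <= p x.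
  move=> h; apply: lb_le_inf => [|_ [[t y] [/= t0 Cy] <-]]; last exact: h.
  by exists (N (x + 0 *: y0) - 0 * m), (0, y0).
have [||l lp] := @hahn_banach p.
- move=> x y; rewrite -lerBlDr; apply: (p_ge) => t1 y1 t10 Cy1.
  rewrite lerBlDr -lerBlDl; apply: p_ge => t2 y2 t20 Cy2.
  have [t00|tn0] := eqVneq (t1 + t2) 0.
    have -> : t1 = 0 by lra.
    have -> : t2 = 0 by lra.
    have := p_le (x + y) 0 y0 (lexx _) Cy0; rewrite !scale0r !addr0 !mul0r.
    have := normD normN x y; lra.
  have tp : 0 < t1 + t2 by rewrite lt_neqAle eq_sym tn0 addr_ge0.
  (* Convexity of [C] merges the two competitors into one with multiplier [t1 + t2]; this is what
     makes [p] subadditive. *)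
  pose y3 := (t1 / (t1 + t2)) *: y1 + (1 - t1 / (t1 + t2)) *: y2.
  have Cy3 : C y3.
    by apply: cC => //; [rewrite divr_ge0// ltW | rewrite ler_pdivrMr// mul1r lerDl].
  have := p_le (x + y) _ _ (ltW tp) Cy3.
  have -> : (t1 + t2) *: y3 = t1 *: y1 + t2 *: y2.
    rewrite /y3 scalerDr !scalerA; congr (_ *: _ + _ *: _); field; exact: tn0.
  rewrite addrACA; have := normD normN (x + t1 *: y1) (y + t2 *: y2); lra.
- move=> a x a0; rewrite mulrC -ler_pdivrMr//; apply: p_ge => t y t0 Cy.
  rewrite ler_pdivrMr//; apply: le_trans (p_le _ (a * t) y _ Cy) _.
    by rewrite mulr_ge0// ltW.
  rewrite -scalerA -scalerDr normZ// gtr0_norm//; lra.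
exists l => [x|y Cy].
  by have := p_le x 0 y0 (lexx _) Cy0; have := lp x; rewrite scale0r addr0 mul0r; lra.
have := p_le (- y) 1 y ler01 Cy; have := lp (- y).
rewrite scale1r addNr norm0// linearN/=; lra.
Qed.

End HahnBanach.

(** * Bounds on upper limits *)

Section LimnEsup.
Context {R : realType}.
Implicit Types (u : (\bar R)^nat) (l : \bar R).

Lemma limn_esup_ge u l : (forall k, (l <= u k)%E) -> (l <= limn_esup u)%E.
Proof.
move=> lu; apply: le_ereal_inf_tmp => _ [S [N _ NS] <-].
by apply: (le_trans (lu N)); apply: ereal_sup_ubound; exists N => //; apply: NS => /=.
Qed.

Lemma limn_esup_le u (l : R) :
  (forall e : R, 0 < e ->
    exists K, forall k, (K <= k)%N -> (u k <= (l + e)%:E)%E) ->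
  (limn_esup u <= l%:E)%E.
Proof.
move=> ul; apply/lee_addgt0Pr => e /ul[K uK].
apply: ge_ereal_inf; exists (ereal_sup (u @` [set k | (K <= k)%N])).
  by exists [set k | (K <= k)%N] => //; exists K.
by apply: ge_ereal_sup => _ [k /= Kk <-]; rewrite -EFinD; exact: uK.
Qed.

End LimnEsup.

(** * Recursion along a play *)

Section Play.
Context {R : realType} {n : nat}.
Local Notation V := 'rV[R]_n.
Variables (sigma : @history R n -> V) (tau : @history R n -> V -> V) (x0 : V).
Local Notation h k := (play sigma tau x0 k).

Lemma total_moveS k : total_move (h k.+1) =
  total_move (h k) + (sigma (h k) + tau (h k) (sigma (h k))).
Proof. by rewrite /total_move /= -cats1 big_cat big_seq1. Qed.

Lemma current_stateS k : current_state (h k.+1) =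
  current_state (h k) + sigma (h k) + tau (h k) (sigma (h k)).
Proof. by rewrite {1}/current_state /= map_rcons last_rcons. Qed.

(** Links the state, at which [phi] is evaluated, to the sum measured by the payoff. *)
Lemma current_state_total_move k :
  current_state (h k) = x0 + total_move (h k).
Proof.
elim: k => [|k IH]; first by rewrite /total_move big_nil addr0.
by rewrite current_stateS total_moveS IH !addrA.
Qed.

End Play.

(** * The gap [lambda] and its dual description by linear forms *)

Section VectorAdditionGame.
Context {R : realType} {n : nat}.
Local Notation V := 'rV[R]_n.
Variables (N : V -> R) (A B : set V).
Hypotheses (normN : is_norm N) (A0 : A !=set0) (B0 : B !=set0).
Hypotheses (cA : compact A) (cB : compact B).

Let coA := convex_hull A.
Let gap (b : V) := min_over coA (fun a => N (a + b)).
Let lambda := max_over B gap.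
Let form_gap (l : {scalar V}) (b : V) := min_over coA (fun a => l (a + b)).
Let phi (x : V) := dist N x [set - (n.+1%:R *: a) | a in coA].

Let coA0 : coA !=set0.
Proof. by case: A0 => a Aa; exists a; exact: sub_convex_hull. Qed.

Let lipN : exists K, lip K N.
Proof. exact: lipschitz1_lip (lipschitz1_norm normN). Qed.

Lemma argmin_gap b : argmin coA (fun a => N (a + b)) !=set0.
Proof.
have [K NK] := lipN; apply: (argmin_lip _ _ (lip_addr _ NK)) => //.
exact: compact_convex_hull.
Qed.

Lemma argmax_gap : argmax B gap !=set0.
Proof.
have [K NK] := lipN; apply: (@argmax_lip _ _ K) => //; apply: lip_min_over.
  exact: argmin_gap.
by move=> a _; exact: lip_addl.
Qed.

Lemma argmin_form (l : {scalar V}) b : argmin coA (fun a => l (a + b)) !=set0.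
Proof.
have [K NK] := linear_lip l; apply: (argmin_lip _ _ (lip_addr _ NK)) => //.
exact: compact_convex_hull.
Qed.

Lemma argmax_form_gap l : argmax B (form_gap l) !=set0.
Proof.
have [K NK] := linear_lip l; apply: (@argmax_lip _ _ K) => //; apply: lip_min_over.
  exact: argmin_form.
by move=> a _; exact: lip_addl.
Qed.

Lemma form_gap_le (l : {scalar V}) b : (forall x, l x <= N x) -> form_gap l b <= gap b.
Proof.
move=> lN; apply: min_over_ge (argmin_gap b) _ => a ha.
exact: le_trans (ge_min_over (argmin_form l b) ha) (lN _).
Qed.

Lemma form_gap_le_lambda (l : {scalar V}) :
  (forall x, l x <= N x) -> max_over B (form_gap l) <= lambda.
Proof.
move=> lN; apply: max_over_le (argmax_form_gap l) _ => b Bb.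
exact: le_trans (form_gap_le _ lN) (le_max_over argmax_gap Bb).
Qed.

Lemma dual_norm1_le (l : {scalar V}) : dual_norm N l <= 1 -> forall x, l x <= N x.
Proof.
by move=> /(dual_normP normN) lN x; exact: le_trans (ler_norm _) (lN x).
Qed.

(** For a maximizer [b] of the gap, the convex set [co(A) + b] has all norms at least [lambda]; the
    separating form reaches [lambda] at [b], and no form below [N] does better. *)
Lemma exists_best_form : exists2 l : {scalar V}, dual_norm N l <= 1 &
  max_over B (form_gap l) = lambda.
Proof.
have [b mb] := argmax_gap; have Bb : B b by case: mb.
have lb : lambda = gap b by exact: max_overE.
have [||y [a ha <-]|l lN lC] :=
    @norm_separation _ _ _ normN [set a + b | a in coA] lambda.
- by case: coA0 => a ha; exists (a + b), a.
- move=> t _ _ t0 t1 [x hx <-] [y hy <-]; exists (t *: x + (1 - t) *: y).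
    exact: convex_hullW.
  by rewrite !scalerDr addrACA -scalerDl [t + _]addrC subrK scale1r.
- by rewrite lb; exact: ge_min_over (argmin_gap b) ha.
exists l.
  (* Since [N] is even, the one-sided bound by [N] also bounds the absolute value. *)
  apply/(dual_normP normN) => x; rewrite ler_norml lN andbT lerNl -linearN.
  by rewrite -(norm_opp normN) lN.
apply/eqP; rewrite eq_le form_gap_le_lambda//=.
apply: le_trans (le_max_over (argmax_form_gap l) Bb).
by apply: min_over_ge (argmin_form l b) _ => a ha; apply: lC; exists a.
Qed.

Let best_forms := argmax [set l : {scalar V} | dual_norm N l <= 1]
    (fun l => max_over B (form_gap l)).

Lemma best_forms_nonempty : best_forms !=set0.
Proof.
have [l l1 ll] := exists_best_form; exists l; split => // l' /= l'1.
by rewrite ll form_gap_le_lambda//; exact: dual_norm1_le.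
Qed.

Lemma best_formE l : best_forms l -> max_over B (form_gap l) = lambda.
Proof.
move=> [/= l1 lmax]; apply/eqP; rewrite eq_le.
rewrite form_gap_le_lambda/=; last exact: dual_norm1_le.
by have [l' l'1 <-] := exists_best_form; exact: lmax.
Qed.

(** * The Shapley operator and its linear eigenvectors *)

Lemma argmax_shapley v x a : lipschitz1 N v ->
  argmax B (fun b => v (x + a + b)) !=set0.
Proof.
by move=> /(lipschitz1_lip normN)[K vK]; exact: (argmax_lip _ _ (lip_addl _ vK)).
Qed.

Lemma argmin_shapley v x : lipschitz1 N v ->
  argmin A (fun a => max_over B (fun b => v (x + a + b))) !=set0.
Proof.
move=> v1; have [K vK] := lipschitz1_lip normN v1.
apply: (@argmin_lip _ _ K) => //; apply: lip_max_over => [a|b _].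
  exact: argmax_shapley.
exact: lip_addl _ (lip_addr _ vK).
Qed.

(** The half-space where [l] is at least [l a] is convex and contains [A]. Hence restricting Min to
    [A] costs nothing against a linear form. *)
Lemma argmin_convex_hull (l : {scalar V}) a : argmin A l a -> argmin coA l a.
Proof.
move=> [Aa la]; split; first exact: sub_convex_hull.
apply: convex_hull_sub => // t x y t0 t1 lx ly.
rewrite linearD !linearZ/=.
have : 0 <= 1 - t by rewrite subr_ge0.
move=> t1'; have := ler_wpM2l t0 lx; have := ler_wpM2l t1' ly; lra.
Qed.

(** Linearity decouples the players: both [S l x - l x] and the maximal [form_gap l] equal the
    minimum of [l] on [A] plus its maximum on [B]. *)
Lemma best_form_eigen l : best_forms l -> eigenproblem_solution N A B lambda l.
Proof.
move=> bl; have l1 : dual_norm N l <= 1 by case: bl.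
have lL : lipschitz1 N l.
  by move=> x y; rewrite -linearB; exact: (iffLR (dual_normP normN l) l1).
split=> // x; have [K lK] := linear_lip l.
have [a ma] := argmin_lip A0 cA lK; have [b mb] := argmax_lip B0 cB lK.
have [Aa la] := ma; have [Bb lb] := mb.
have [ca lca] := argmin_convex_hull ma.
have gapE c : form_gap l c = l a + l c.
  rewrite /form_gap (@min_overE _ _ _ _ a) ?linearD//.
  by split=> // y hy; rewrite !linearD/= lerD2r lca.
have maxE c : max_over B (fun b' => l (x + c + b')) = l (x + c + b).
  apply: max_overE; split=> // y By.
  by rewrite (linearD l _ y) (linearD l _ b) lerD2l lb.
rewrite -(best_formE bl) (@max_overE _ _ _ _ b); last first.
  by split=> // y By; rewrite !gapE lerD2l lb.
rewrite /shapley (@min_overE _ _ _ _ a); last first.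
  by split=> // y Ay; rewrite !maxE !linearD/= lerD2r lerD2l la.
by rewrite maxE gapE !linearD/=; ring.
Qed.

(** * Constant play of Max *)

Lemma constant_play sigma b x0 k : min_strategies A sigma ->
  exists2 c, coA c &
    total_move (play sigma (fun _ _ => b) x0 k.+1) = k.+1%:R *: (c + b).
Proof.
move=> sA; elim: k => [|k [c hc IH]].
  exists (sigma (x0, [::])); first by apply: sub_convex_hull; exact: sA.
  by rewrite total_moveS /total_move big_nil add0r scale1r.
set a := sigma (play sigma (fun _ _ => b) x0 k.+1).
(* The point [c] is the running mean of Min's actions; [t] is the weight of the old mean when one
   more action is averaged in. *)
pose t : R := k.+1%:R / k.+2%:R.
exists (t *: c + (1 - t) *: a).
  apply: convex_hullW => //; last by apply: sub_convex_hull; exact: sA.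
    by rewrite divr_ge0.
  by rewrite ler_pdivrMr// mul1r ler_nat.
have k2 : k.+2%:R = k.+1%:R + 1 :> R by rewrite natr1.
have k0 : k.+2%:R != 0 :> R by rewrite pnatr_eq0.
rewrite total_moveS IH -/a !scalerDr !scalerA.
have -> : k.+2%:R * t = k.+1%:R by rewrite mulrC divfK.
have -> : k.+2%:R * (1 - t) = 1 :> R.
  by rewrite mulrBr mulr1 [_ * t]mulrC divfK// k2 addrAC subrr add0r.
by rewrite k2 scalerDl !scale1r addrACA.
Qed.

(** The averaged norm is at least [lambda] at every turn, not only in the limit. *)
Lemma constant_optimal b x0 : argmax B gap b ->
  optimal_max N A B x0 lambda (fun _ _ => b).
Proof.
move=> mb; split; first by move=> _ _; case: mb.
move=> sigma sA; apply: limn_esup_ge => k; rewrite lee_fin.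
have [c hc ->] := constant_play b x0 k sA.
rewrite normZ// ger0_norm// mulrAC divff ?pnatr_eq0// mul1r.
by rewrite /lambda (max_overE mb); exact: ge_min_over (argmin_gap b) hc.
Qed.

(** * The distance-like function [phi] *)

Lemma phiE x : phi x = min_over coA (fun a => N (x + n.+1%:R *: a)).
Proof.
congr inf; apply/seteqP; split=> [_ [_ [a ha <-] <-]|_ [a ha <-]].
  by exists a; rewrite ?opprK.
by exists (- (n.+1%:R *: a)); [exists a | rewrite opprK].
Qed.

Lemma argmin_phi x : argmin coA (fun a => N (x + n.+1%:R *: a)) !=set0.
Proof.
have [K NK] := lipN; apply: (@argmin_lip _ _ (`|K| * n.+1%:R)) => //.
  exact: compact_convex_hull.
move=> a b; apply: le_trans (lip_addl x NK _ _) _.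
rewrite -scalerBr mx_normZ ger0_norm// mulrA !ler_wpM2r// ler_norm//.
Qed.

Lemma phi_le x a : coA a -> phi x <= N (x + n.+1%:R *: a).
Proof. by rewrite phiE; exact: ge_min_over (argmin_phi x). Qed.

Lemma phi_lipschitz : lipschitz1 N phi.
Proof.
have h x y : phi x - phi y <= N (x - y).
  have [a ma] := argmin_phi y; rewrite [phi y]phiE (min_overE ma).
  have := phi_le x (a := a); case: ma => ha _ /(_ ha).
  have := normD normN (x - y) (y + n.+1%:R *: a); rewrite addrA subrK; lra.
move=> x y; have := h x y; have := h y x; rewrite (normB normN y x) ler_norml; lra.
Qed.

Lemma phi_distance_like : distance_like N phi.
Proof.
split; first exact: phi_lipschitz.
have [K NK] := lipN.
have [m [hm mm]] : argmax coA N !=set0.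
  by apply: (argmax_lip _ _ NK) => //; exact: compact_convex_hull.
(* The constant is minus the largest norm on [(n+1) co(A)], as the triangle inequality requires. *)
exists 0, (- (n.+1%:R * N m)) => x; rewrite subr0 phiE.
apply: min_over_ge (argmin_phi x) _ => a ha.
have := normD normN (x + n.+1%:R *: a) (- (n.+1%:R *: a)).
rewrite addrK norm_opp// normZ// ger0_norm//.
have := ler_wpM2l (ler0n R n.+1) (mm _ ha); lra.
Qed.

Lemma shapley_phi x : shapley A B phi x <= lambda + phi x.
Proof.
have [c mc] := argmin_phi x; have [hc _] := mc.
have [a Aa exa] := convex_hull_exchange hc.
apply: le_trans (ge_min_over (argmin_shapley x phi_lipschitz) Aa) _.
apply: max_over_le (argmax_shapley x a phi_lipschitz) _ => b Bb.
(* Min's action [a] is already fixed; only the comparison point [a'] depends on the reply [b]. *)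
have [a' ma'] := argmin_gap b; have [ha' _] := ma'.
apply: le_trans (phi_le _ (exa _ ha')) _.
(* The factor [n + 1] makes the exchanged mass a full unit, so the action [a] cancels. *)
have -> : x + a + b + n.+1%:R *: (c + n.+1%:R^-1 *: (a' - a)) =
          (a' + b) + (x + n.+1%:R *: c).
  rewrite scalerDr scalerA divff ?pnatr_eq0// scale1r.
  by apply/rowP => i; rewrite !mxE; ring.
apply: le_trans (normD normN _ _) _.
rewrite [phi x]phiE (min_overE mc) lerD2r.
by rewrite -(min_overE ma'); exact: le_max_over argmax_gap Bb.
Qed.

(** * The stationary strategy of Min *)

Section MinStrategy.
Variable s : V -> V.
Hypothesis sE : forall x,
  argmin A (fun a => max_over B (fun b => phi (x + a + b))) (s x).
Let sigma (h : @history R n) := s (current_state h).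

Lemma phi_play tau x0 k : max_strategies B tau ->
  phi (current_state (play sigma tau x0 k)) <= phi x0 + k%:R * lambda.
Proof.
move=> tB; elim: k => [|k IH]; first by rewrite mul0r addr0.
rewrite current_stateS; set h := play sigma tau x0 k in IH *.
have := le_max_over (argmax_shapley (current_state h) (sigma h) phi_lipschitz)
  (tB h (sigma h)).
rewrite -(min_overE (sE _)) => /le_trans/(_ (shapley_phi _)) h1.
apply: le_trans h1 _; rewrite -natr1; lra.
Qed.

(** Along the play [phi] grows by at most [lambda] per turn, and being distance-like it controls the
    norm up to a constant, which disappears after division by the number of turns. *)
Lemma stationary_optimal x0 : optimal_min N A B x0 lambda sigma.
Proof.
split; first by move=> h; case: (sE (current_state h)).
move=> tau tB; apply: limn_esup_le => e e0.
have [_ [y0 [alpha phi_ge]]] := phi_distance_like.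
(* The last term pays for moving the centre from [y0] to the initial state [x0]. *)
pose M := phi x0 - alpha + N (y0 - x0).
have Mk k : N (total_move (play sigma tau x0 k)) <= M + k%:R * lambda.
  have := phi_play x0 k tB; rewrite current_state_total_move.
  set z := total_move _; have := phi_ge (x0 + z).
  have := normD normN (x0 + z - y0) (y0 - x0).
  rewrite addrA subrK [x0 + z - x0]addrAC subrr add0r /M; lra.
have [K MK] : exists K : nat, M / e <= K%:R.
  exists (Num.Def.archi_bound `|M / e|); apply: le_trans (ler_norm _) _.
  by rewrite ltW// archi_boundP.
(* The term of index [k] concerns turn [k + 1], hence the final step from [k] to its successor. *)
exists K => k Kk; rewrite lee_fin ler_pdivrMr//.
apply: le_trans (Mk _) _; rewrite mulrDl addrC mulrC lerD2l.
rewrite mulrC -ler_pdivrMr// (le_trans MK)// ler_nat.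
exact: leq_trans Kk (leqnSn _).
Qed.

End MinStrategy.

(** The two optimal strategies form a saddle point: each one's guarantee bounds both iterated
    extrema from one side. *)
Lemma game_has_value x0 : has_value N A B x0 lambda.
Proof.
have [b mb] := argmax_gap.
have [tB optB] := constant_optimal x0 mb.
have /choice[s sE] : forall x, exists a,
    argmin A (fun a => max_over B (fun b => phi (x + a + b))) a.
  by move=> x; exact: argmin_shapley phi_lipschitz.
have [sA optA] := stationary_optimal sE x0.
split; apply/eqP; rewrite eq_le; apply/andP; split.
- apply: ge_ereal_inf; eexists; first by eexists; [exact: sA | reflexivity].
  by apply: ge_ereal_sup => _ [tau tauB <-]; exact: optA.
- apply: le_ereal_inf_tmp => _ [sigma sigmaA <-].
  apply: le_trans (optB _ sigmaA) _.
  by apply: ereal_sup_ubound; exists (fun _ _ => b).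
- apply: ge_ereal_sup => _ [tau tauB <-].
  apply: le_trans (optA _ tauB).
  by apply: ereal_inf_lbound; eexists; [exact: sA | reflexivity].
- apply: le_trans (ereal_sup_ubound _); last by exists (fun _ _ => b).
  by apply: le_ereal_inf_tmp => _ [sigma sigmaA <-]; exact: optB.
Qed.

End VectorAdditionGame.
Unset Implicit Arguments.
Set Strict Implicit.

Theorem proposition39 (R : realType) (n : nat) (N : 'rV[R]_n -> R)
    (A B : set 'rV[R]_n) (normN : is_norm N)
    (A0 : A !=set0) (B0 : B !=set0) (cA : compact A) (cB : compact B) :
  let coA := convex_hull A in
  let gap (b : 'rV[R]_n) := min_over coA (fun a => N (a + b)) in
  let lambda := max_over B gap in
  let form_gap (l : {scalar 'rV[R]_n}) (b : 'rV[R]_n) :=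
    min_over coA (fun a => l (a + b)) in
  let best_forms := argmax [set l : {scalar 'rV[R]_n} | dual_norm N l <= 1]
    (fun l => max_over B (form_gap l)) in
  let phi (x : 'rV[R]_n) := dist N x [set - (n.+1%:R *: a) | a in coA] in
  (* the minima and maxima below are attained *)
  [/\ forall b, argmin coA (fun a => N (a + b)) !=set0,
      argmax B gap !=set0,
      forall (l : {scalar 'rV[R]_n}) b,
        argmin coA (fun a => l (a + b)) !=set0,
      forall l, argmax B (form_gap l) !=set0 &
      best_forms !=set0] /\
  (forall v, lipschitz1 N v -> forall x,
     (forall a, argmax B (fun b => v (x + a + b)) !=set0) /\
     argmin A (fun a => max_over B (fun b => v (x + a + b))) !=set0) /\
  [/\ forall x0, has_value N A B x0 lambda,
      forall l, best_forms l -> eigenproblem_solution N A B lambda l,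
      forall bstar, argmax B gap bstar ->
        forall x0, optimal_max N A B x0 lambda (fun _ _ => bstar),
      distance_like N phi /\
      (forall x, shapley A B phi x <= lambda + phi x) &
      forall s : 'rV[R]_n -> 'rV[R]_n,
        (forall x, argmin A (fun a => max_over B (fun b => phi (x + a + b)))
                     (s x)) ->
        let sigma := fun h => s (current_state h) in
        stationary sigma /\ forall x0, optimal_min N A B x0 lambda sigma].
Proof.
move=> coA gap lambda form_gap best_forms phi; split; [|split].
- split.
  + by move=> b; exact: argmin_gap.
  + exact: argmax_gap.
  + by move=> l b; exact: argmin_form.
  + by move=> l; exact: argmax_form_gap.
  + exact: best_forms_nonempty.
- move=> v v1 x; split; last exact: (argmin_shapley normN).
  by move=> a; exact: (argmax_shapley normN).
- split.
  + by move=> x0; exact: game_has_value.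
  + by move=> l; exact: best_form_eigen.
  + by move=> b mb x0; exact: constant_optimal.
  + by split; [exact: phi_distance_like | move=> x; exact: shapley_phi].
  + move=> s sE sigma; split; first by move=> h h' hh'; rewrite /sigma hh'.
    by move=> x0; exact: stationary_optimal.
Qed.
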